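(* Let $\alpha=(\alpha_1,\ldots,\alpha_s)$ be a composition (a sequence of positive integers) such that for some index $t$ $$\alpha_t>\sum_{i\ne t}\alpha_i,$$ and let $$\beta=(\alpha_1,\ldots,\alpha_{t-1},\alpha_t+1,\alpha_{t+1},\ldots,\alpha_s).$$ Put $L=L(\alpha)$ and $M=L(\beta)$. If $L$ has a nested chain decomposition (NCD), then so does $M$. Furthermore, if $L$ has an NCD which is symmetric, top centered, or bottom centered, then $M$ has an NCD which is, respectively, symmetric, top centered, or bottom centered.
   Context: For a composition $\alpha=(\alpha_1,\ldots,\alpha_s)$ of $n-1$ (positive integers with sum $n-1$), the fence poset $F(\alpha)$ has elements $x_1,\ldots,x_n$. For $1\le i\le s$ its $i$th segment is the set $\{x_j : \alpha_1+\cdots+\alpha_{i-1}+1\le j\le \alpha_1+\cdots+\alpha_i+1\}$. The covering relations are: consecutive elements of the $i$th segment satisfy $x_j\lhd x_{j+1}$ if $i$ is odd and $x_j\rhd x_{j+1}$ if $i$ is even. $L(\alpha)$ is the distributive lattice of all lower order ideals of $F(\alpha)$ ordered by inclusion; it is ranked by cardinality of ideals, so its rank is $\#F(\alpha)$. Let $P$ be a ranked poset of rank $N$. A chain decomposition (CD) of $P$ is a set partition of $P$ into saturated chains. If $C$ is a saturated chain with minimum $x$ and maximum $y$, its center is $\operatorname{cen} C=(\operatorname{rk}x+\operatorname{rk}y)/2$ and its interval is the integer interval $[C]=[\operatorname{rk}x,\operatorname{rk}y]$. A CD is nested (an NCD) if any two of its chains $C,D$ satisfy $[C]\subseteq[D]$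 or $[D]\subseteq[C]$. A CD is symmetric if every chain $C$ in it has $\operatorname{cen}C=N/2$; top centered if every chain $C$ in it has $\operatorname{cen}C\in\{N/2,(N+1)/2\}$; bottom centered if every chain $C$ in it has $\operatorname{cen}C\in\{N/2,(N-1)/2\}$. (Each of these three kinds of CD is an NCD.) *)

(* Defs.v *)
From HB Require Import structures.
From mathcomp Require Import all_boot all_order all_algebra.

Set Implicit Arguments.
Unset Strict Implicit.
Unset Printing Implicit Defensive.

Import Order.TTheory GRing.Theory Num.Theory.

Section ChainDecompositions.
Context {d : Order.disp_t} {T : finPOrderType d}.

Definition covers (x y : T) : bool :=
  (x < y)%O && [forall z : T, ~~ (x < z < y)%O].

Definition saturated_chain (C : {set T}) : Prop :=
  exists (x : T) (s : seq T), path covers x s /\ C = [set z in x :: s].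

Definition chain_decomposition (D : {set {set T}}) : Prop :=
  partition D [set: T] /\ forall C, C \in D -> saturated_chain C.

Definition is_min (C : {set T}) (x : T) : bool :=
  (x \in C) && [forall z in C, (x <= z)%O].

Definition is_max (C : {set T}) (y : T) : bool :=
  (y \in C) && [forall z in C, (z <= y)%O].

(* A saturated chain in a finite poset has exactly one minimum and exactly one
   maximum, so quantifying over them amounts to naming them. *)
Context (rk : T -> nat) (N : nat).

Definition interval_of (x y : T) : pred nat := [pred k | rk x <= k <= rk y].

Definition nested (D : {set {set T}}) : Prop :=
  forall C C' x y x' y', C \in D -> C' \in D ->
    is_min C x -> is_max C y -> is_min C' x' -> is_max C' y' ->
    {subset interval_of x y <= interval_of x' y'} \/
    {subset interval_of x' y' <= interval_of x y}.

Definition center_of (x y : T) : rat := (((rk x)%:R + (rk y)%:R) / 2)%R.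

Definition centers_in (D : {set {set T}}) (cs : seq rat) : Prop :=
  forall C x y, C \in D -> is_min C x -> is_max C y -> center_of x y \in cs.

Definition NCD (D : {set {set T}}) : Prop := chain_decomposition D /\ nested D.

Definition symmetric_CD (D : {set {set T}}) : Prop :=
  centers_in D [:: N%:R / 2]%R.

Definition top_centered_CD (D : {set {set T}}) : Prop :=
  centers_in D [:: N%:R / 2; (N%:R + 1) / 2]%R.

Definition bottom_centered_CD (D : {set {set T}}) : Prop :=
  centers_in D [:: N%:R / 2; (N%:R - 1) / 2]%R.

End ChainDecompositions.

Definition composition (alpha : seq nat) : bool := all (fun a => 0 < a) alpha.

(* Indices start at 0: element [j] is x_(j+1) and segment [i] is the (i+1)-st
   one, so the ascending segments are those with [i] even. *)
Record fence (alpha : seq nat) : Type := Elt { fence_ord : 'I_(sumn alpha).+1 }.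

HB.instance Definition _ alpha := [isNew for @fence_ord alpha].
HB.instance Definition _ alpha := [Finite of fence alpha by <:].

Definition fence_index (alpha : seq nat) (x : fence alpha) : nat := fence_ord x.

Lemma fence_index_inj alpha : injective (@fence_index alpha).
Proof. by move=> x y xy; apply/val_inj/val_inj. Qed.

Definition segment (alpha : seq nat) (i : nat) : {set fence alpha} :=
  [set x | sumn (take i alpha) <= fence_index x <= sumn (take i.+1 alpha)].

Definition fence_cover (alpha : seq nat) : rel (fence alpha) :=
  [rel x y | [exists i : 'I_(size alpha),
    [&& x \in segment alpha i, y \in segment alpha i
      & if odd i then fence_index x == (fence_index y).+1
        else fence_index y == (fence_index x).+1]]].

Definition fence_le (alpha : seq nat) : rel (fence alpha) :=
  connect (@fence_cover alpha).

Lemma segment_edge_inj alpha i i' (x y : fence alpha) :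
    fence_index y = (fence_index x).+1 ->
    x \in segment alpha i -> y \in segment alpha i ->
    x \in segment alpha i' -> y \in segment alpha i' -> i = i'.
Proof.
have mono m n : m <= n -> sumn (take m alpha) <= sumn (take n alpha).
  move=> lemn; rewrite -(subnKC lemn) takeD sumn_cat; exact: leq_addr.
move=> yx; rewrite !inE yx.
move=> /andP[a _] /andP[_ b] /andP[a' _] /andP[_ b'].
case: (ltngtP i i') => // lt.
- by have := leq_trans (leq_trans b (mono _ _ lt)) a'; rewrite ltnn.
- by have := leq_trans (leq_trans b' (mono _ _ lt)) a; rewrite ltnn.
Qed.

(* An ascent (resp. descent) through every edge between the indices. *)
Lemma fence_le_edge alpha (x y : fence alpha) (j : nat) : fence_le x y ->
  (fence_index x <= j < fence_index y ->
     exists u v : fence alpha,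
       [/\ fence_index u = j, fence_index v = j.+1 & fence_cover u v]) /\
  (fence_index y <= j < fence_index x ->
     exists u v : fence alpha,
       [/\ fence_index u = j, fence_index v = j.+1 & fence_cover v u]).
Proof.
case/connectP=> s; elim: s x => [|z s IH] x /=.
  by move=> _ ->; split=> /andP[h]; rewrite ltnNge h.
case/andP=> xz /IH{}IH /IH[{}IHu IHd].
have step : fence_index z = (fence_index x).+1 \/
            fence_index x = (fence_index z).+1.
  by move: xz => /existsP[i /and3P[_ _]]; case: ifP => _ /eqP ->; [right|left].
split=> /andP[lo hi].
- have [zj|jz] := leqP (fence_index z) j; first by apply: IHu; rewrite zj.
  case: step => st; last by move: jz; rewrite ltnNge (leq_trans _ lo) ?st.
  exists x, z; suff -> : j = fence_index x by [].
  by apply/eqP; rewrite eqn_leq lo andbT -ltnS -st.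
- have [jz|zj] := ltnP j (fence_index z); first by apply: IHd; rewrite lo.
  case: step => st.
    by move: hi; rewrite ltnNge (leq_trans _ zj) ?st.
  exists z, x; suff -> : j = fence_index z by [].
  by apply/eqP; rewrite eqn_leq zj andbT -ltnS -st.
Qed.

Lemma fence_cover_asym alpha (x y : fence alpha) :
  fence_index y = (fence_index x).+1 -> fence_cover x y -> ~~ fence_cover y x.
Proof.
move=> yx /existsP[i /and3P[xi yi hi]].
apply/negP=> /existsP[i' /and3P[yi' xi' hi']].
have ei := segment_edge_inj yx xi yi xi' yi'.
move: hi hi'; rewrite -ei yx.
have neq n : (n == n.+2) = false by apply/negbTE; rewrite neq_ltn ltnS leqnSn.
by case: (odd i); rewrite ?eqxx ?neq // => _; rewrite neq.
Qed.

Lemma fence_le_refl alpha : reflexive (@fence_le alpha).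
Proof. exact: connect0. Qed.

Lemma fence_le_trans alpha : transitive (@fence_le alpha).
Proof. exact: connect_trans. Qed.

Lemma fence_le_anti alpha : antisymmetric (@fence_le alpha).
Proof.
have main (x y : fence alpha) : fence_index x < fence_index y ->
    fence_le x y -> ~~ fence_le y x.
  move=> lt xy; apply/negP=> yx.
  have r : fence_index x <= fence_index x < fence_index y by rewrite leqnn.
  have [u [v [eu ev uv]]] := (fence_le_edge (fence_index x) xy).1 r.
  have [u' [v' [eu' ev' vu']]] := (fence_le_edge (fence_index x) yx).2 r.
  have uu : u' = u by apply: fence_index_inj; rewrite eu'.
  have vv : v' = v by apply: fence_index_inj; rewrite ev'.
  move: vu'; rewrite uu vv; apply/negP; apply: fence_cover_asym uv.
  by rewrite ev eu.
move=> x y /andP[xy yx]; apply: fence_index_inj.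
by case: (ltngtP (fence_index x) (fence_index y)) => // lt;
  [have /negP := main _ _ lt xy|have /negP := main _ _ lt yx].
Qed.

Fact fence_display : Order.disp_t. Proof. exact: Order.Disp tt tt. Qed.

HB.instance Definition _ alpha :=
  Order.Le_isPOrder.Build fence_display (fence alpha)
    (@fence_le_refl alpha) (@fence_le_anti alpha) (@fence_le_trans alpha).

Definition lower_ideal (alpha : seq nat) (I : {set fence alpha}) : bool :=
  [forall x, forall y, (x <= y)%O && (y \in I) ==> (x \in I)].

Record L (alpha : seq nat) : Type := Ideal {
  ideal_set : {set fence alpha};
  idealP : lower_ideal ideal_set
}.

HB.instance Definition _ alpha := [isSub for @ideal_set alpha].
HB.instance Definition _ alpha := [Finite of L alpha by <:].

Definition ideal_le (alpha : seq nat) : rel (L alpha) :=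
  [rel I J | ideal_set I \subset ideal_set J].

Lemma ideal_le_refl alpha : reflexive (@ideal_le alpha).
Proof. by move=> I; apply: subxx. Qed.

Lemma ideal_le_anti alpha : antisymmetric (@ideal_le alpha).
Proof. by move=> I J IJ; apply/val_inj/eqP; rewrite eqEsubset. Qed.

Lemma ideal_le_trans alpha : transitive (@ideal_le alpha).
Proof. by move=> J I K; apply: subset_trans. Qed.

Fact ideal_display : Order.disp_t. Proof. exact: Order.Disp tt tt. Qed.

HB.instance Definition _ alpha :=
  Order.Le_isPOrder.Build ideal_display (L alpha)
    (@ideal_le_refl alpha) (@ideal_le_anti alpha) (@ideal_le_trans alpha).

Definition ideal_rank (alpha : seq nat) (I : L alpha) : nat := #|ideal_set I|.

Lemma leL alpha (I J : L alpha) :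
  (I <= J)%O = (ideal_set I \subset ideal_set J).
Proof. by []. Qed.

Lemma idealE alpha (I : L alpha) (x y : fence alpha) :
  (x <= y)%O -> y \in ideal_set I -> x \in ideal_set I.
Proof.
move=> xy yI; have /forallP /(_ x) /forallP /(_ y) /implyP := idealP I.
by apply; rewrite xy.
Qed.

(* Cardinality is the rank function of [L alpha]. *)
Lemma ideal_rank_covers alpha (I J : L alpha) :
  covers I J -> ideal_rank J = (ideal_rank I).+1.
Proof.
case/andP=> ltIJ /forallP noK; rewrite /ideal_rank.
have : (I <= J)%O && ~~ (J <= I)%O by rewrite -lt_leAnge.
rewrite !leL => /andP[sIJ /subsetPn[z0 z0J z0I]].
pose A := [pred z | (z \in ideal_set J) && (z \notin ideal_set I)].
have Az0 : A z0 by rewrite /= z0J.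
pose f (z : fence alpha) := #|[set w : fence alpha | (w <= z)%O]|.
case: (arg_minnP f Az0) => z /andP[zJ zI] zmin.
have low w : (w < z)%O -> w \in ideal_set I.
  move=> wz; apply: contraT => wI.
  have /zmin : A w by rewrite /= wI (idealE (ltW wz) zJ).
  rewrite leqNgt => /negP[]; apply: proper_card; apply/properP; split.
    by apply/subsetP=> v; rewrite !inE => /le_trans; apply; apply: ltW.
  by exists z; rewrite !inE ?lexx // lt_geF.
have idK : lower_ideal (z |: ideal_set I).
  apply/forallP=> x; apply/forallP=> y; apply/implyP=> /andP[xy].
  rewrite !in_setU1 => yK.
  case/predU1P: yK => [yz|yI]; last by rewrite (idealE xy yI) orbT.
  by move: xy; rewrite yz le_eqVlt => /predU1P[->|/low ->]; rewrite ?eqxx ?orbT.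
pose K := Ideal idK.
have IK : (I < K)%O.
  rewrite lt_leAnge !leL subsetUr; apply/subsetPn.
  by exists z => //; apply: setU11.
have KJ : (K <= J)%O by rewrite leL subUset sub1set zJ.
move: (noK K); rewrite IK /= lt_neqAle KJ andbT negbK => /eqP <-.
by rewrite [ideal_set K]/(z |: ideal_set I) cardsU1 zI.
Qed.

(* Main.v *)
Require Import Defs.
From mathcomp Require Import all_boot all_order all_algebra zify.

(* Write a for the t-th part and pick m with (sum of the other parts) < m <= a.
   An ideal of F(alpha) of rank at most m misses the top of the t-th segment and
   one of rank at least m contains its bottom. Doubling the top therefore
   identifies the ranks <= m of L(alpha) with those of L(beta), and doubling the
   bottom identifies the ranks >= m of L(alpha) with the ranks >= m + 1 of
   L(beta); on rank m, the first image of an ideal is covered by the second.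
   Cutting every chain of a decomposition at rank m and inserting this extra
   covering yields a decomposition of L(beta) in which the rank intervals are
   transformed by monotone maps, so nestedness survives. Every chain containing
   rank m has its center raised by 1/2; for the centered decompositions all
   chains contain a suitable middle rank m. *)

Set Implicit Arguments.
Unset Strict Implicit.
Unset Printing Implicit Defensive.

Import Order.TTheory GRing.Theory Num.Theory.

(** * Minimum and maximum of a saturated chain *)

Section ChainEnds.
Context {d : Order.disp_t} {T : finPOrderType d}.
Implicit Types (x y : T) (C : {set T}) (s : seq T).

Lemma covers_path_sorted x s : path covers x s -> sorted <=%O (x :: s).
Proof. by apply: sub_path => y z /andP[/ltW]. Qed.

Lemma is_min_head x s : path covers x s -> is_min [set z in x :: s] x.
Proof.
move=> /covers_path_sorted /= /(order_path_min le_trans) /allP xs.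
rewrite /is_min !inE eqxx; apply/forallP=> z; apply/implyP.
by rewrite !inE => /predU1P[->|/xs].
Qed.

Lemma is_max_last x s : path covers x s -> is_max [set z in x :: s] (last x s).
Proof.
rewrite /is_max !inE -in_cons mem_last /= => xs.
apply/forallP=> z; apply/implyP; rewrite inE => zs.
elim: s x xs zs => [|y s IH] x /=; first by rewrite mem_seq1 => _ /eqP->.
case/andP=> /andP[/ltW xy _] /[dup] /is_min_head /andP[_ /forallP ymin] ys.
rewrite in_cons => /predU1P[->|/(IH _ ys)//].
by apply: le_trans xy (implyP (ymin _) _); rewrite inE mem_last.
Qed.

Lemma is_min_unique C x y : is_min C x -> is_min C y -> x = y.
Proof.
move=> /andP[xC /forallP xmin] /andP[yC /forallP ymin]; apply/le_anti.
by rewrite (implyP (xmin y)) // (implyP (ymin x)).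
Qed.

Lemma is_max_unique C x y : is_max C x -> is_max C y -> x = y.
Proof.
move=> /andP[xC /forallP xmax] /andP[yC /forallP ymax]; apply/le_anti.
by rewrite (implyP (ymax x)) // (implyP (xmax y)).
Qed.

End ChainEnds.

(** * Stretching a chain decomposition at one rank *)

(** The hypothesis makes the first interval nonempty; an empty one would be included in
    everything. *)
Lemma interval_subsetP {d : Order.disp_t} {T : finPOrderType d} (r : T -> nat)
    (x y x' y' : T) : r x <= r y ->
  {subset interval_of r x y <= interval_of r x' y'} <->
  (r x' <= r x) && (r y <= r y').
Proof.
move=> xy; split=> [sub|/andP[h1 h2] k]; last by rewrite !inE; lia.
by have := sub (r x); have := sub (r y); rewrite !inE; lia.
Qed.

(* [f] embeds the ranks at most [m] of [T] without shift, [g] embeds the ranks at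
   least [m] with a shift by one; rank [m] is embedded twice. *)
Section Stretching.
Context {d d' : Order.disp_t} {T : finPOrderType d} {U : finPOrderType d'}.
Context (rT : T -> nat) (rU : U -> nat) (m : nat) (f g : T -> U).

Definition stretch (C : {set T}) : {set U} :=
  f @: [set x in C | rT x <= m] :|: g @: [set x in C | m <= rT x].

Context (rT_covers : forall x y : T, covers x y -> rT y = (rT x).+1).
Context (f_inj : injective f) (g_inj : injective g).
Context (rU_f : forall x, rT x <= m -> rU (f x) = rT x).
Context (rU_g : forall x, m <= rT x -> rU (g x) = (rT x).+1).
Context (f_covers : forall x y, rT y <= m -> covers x y -> covers (f x) (f y)).
Context (g_covers : forall x y, m <= rT x -> covers x y -> covers (g x) (g y)).
Context (fg_covers : forall x, rT x = m -> covers (f x) (g x)).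
Context (f_surj : forall u, rU u <= m -> exists2 x, rT x <= m & u = f x).
Context (g_surj : forall u, m < rU u -> exists2 x, m <= rT x & u = g x).

(** At rank [m] both copies of [x] enter the new chain: [f x] is its start if the old chain began
    there, and [g x] its end if the old chain stopped there. Hence the tie is broken differently in
    the two definitions. *)
Definition stretch_min x := if rT x <= m then f x else g x.
Definition stretch_max x := if m <= rT x then g x else f x.

Lemma mem_stretch C u :
  (u \in stretch C) = [exists x in C, (rT x <= m) && (u == f x)
                                   || (m <= rT x) && (u == g x)].
Proof.
apply/setUP/exists_inP => [[]/imsetP[x]|[x xC]].
- by rewrite inE => /andP[xC xm] ->; exists x; rewrite // xm eqxx.
- by rewrite inE => /andP[xC xm] ->; exists x; rewrite // xm eqxx orbT.
- by case/orP=> /andP[xm /eqP->]; [left|right]; apply: imset_f; rewrite inE xC.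
Qed.

Lemma stretch_cons x s : rT x != m ->
  stretch [set z in x :: s] = stretch_min x |: stretch [set z in s].
Proof.
move=> xm; apply/setP=> u; rewrite in_setU1 !mem_stretch /stretch_min.
apply/exists_inP/orP => [[y]|[/eqP->|/exists_inP[y ys yu]]].
- rewrite !inE => /predU1P[->|ys yu].
    2: by right; apply/exists_inP; exists y; rewrite ?inE.
  by case: (ltngtP (rT x) m) xm => //= _ _; rewrite ?orbF; left.
- exists x; first by rewrite inE mem_head.
  by case: (ltngtP (rT x) m) xm => //=; rewrite eqxx.
- by exists y => //; move: ys; rewrite !inE => ->; rewrite orbT.
Qed.

Lemma stretch_cons_eq x s : rT x = m ->
  stretch [set z in x :: s] = f x |: (g x |: stretch [set z in s]).
Proof.
move=> xm; apply/setP=> u; rewrite !in_setU1 !mem_stretch.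
apply/exists_inP/or3P => [[y]|[/eqP->|/eqP->|/exists_inP[y ys yu]]].
- rewrite !inE => /predU1P[->|ys yu].
    2: by constructor 3; apply/exists_inP; exists y; rewrite ?inE.
  by rewrite xm leqnn => /orP[]; [constructor 1|constructor 2].
- by exists x; rewrite ?inE ?eqxx // xm leqnn.
- by exists x; rewrite ?inE ?eqxx // xm leqnn orbT.
- by exists y => //; move: ys; rewrite !inE => ->; rewrite orbT.
Qed.

(** Ranks grow by one along the chain, so every link lies within ranks at most [m] or within ranks
    at least [m], and [f] or [g] carries it over; at rank [m] the link from [f x] to [g x] is
    inserted. *)
Lemma stretch_path x s : path covers x s ->
  exists w, [/\ path covers (stretch_min x) w,
    stretch [set z in x :: s] = [set u in stretch_min x :: w]
    & last (stretch_min x) w = stretch_max (last x s)].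
Proof.
have nil0 : stretch [set z in [::]] = set0.
  by apply/setP=> u; rewrite mem_stretch inE; apply/exists_inP=> -[y]; rewrite inE.
have consE (u : U) w : [set v in u :: w] = u |: [set v in w].
  by apply/setP=> v; rewrite !inE.
elim: s x => [|y s IH] x /=.
  move=> _; have [xm|xm] := eqVneq (rT x) m.
    exists [:: g x].
    rewrite stretch_cons_eq // nil0 /stretch_min /stretch_max xm leqnn /=.
    by rewrite fg_covers //; split=> //; rewrite !consE set_nil.
  exists [::]; rewrite stretch_cons // nil0 consE set_nil; split=> //.
  by rewrite /stretch_min /stretch_max /=; case: ltngtP xm.
case/andP=> xy /IH[w [yw eqw lastw]]; have rxy := rT_covers xy.
have [xm|xm] := eqVneq (rT x) m.
  have ym : stretch_min y = g y by rewrite /stretch_min rxy xm ltnn.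
  rewrite ym in yw eqw lastw; exists [:: g x, g y & w].
  rewrite stretch_cons_eq // eqw !consE /stretch_min xm leqnn /=.
  by rewrite fg_covers // g_covers ?xm.
exists (stretch_min y :: w); rewrite stretch_cons // eqw !consE /= yw andbT.
split=> //; rewrite /stretch_min rxy.
case: (ltngtP (rT x) m) xm => // xm _; first by apply: f_covers; rewrite ?rxy.
by apply: g_covers; rewrite ?(ltnW xm).
Qed.

Lemma rank_path x s : path covers x s -> rT x <= rT (last x s).
Proof.
elim: s x => //= y s IH x /andP[/rT_covers rxy /IH]; apply: leq_trans.
by rewrite rxy.
Qed.

Lemma stretch_CD (D : {set {set T}}) :
  chain_decomposition D -> chain_decomposition (stretch @: D).
Proof.
case=> /and3P[/eqP covD trivD D0] satD; split; last first.
  move=> _ /imsetP[C /satD[x [s [xs ->]]] ->].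
  by have [w [uw -> _]] := stretch_path xs; exists (stretch_min x), w.
(* An element of [U] has a single source in [T]: [f] yields ranks at most [m] and [g] ranks above
   [m], and both are injective. *)
have block C C' u : C \in D -> C' \in D ->
    u \in stretch C -> u \in stretch C' -> C = C'.
  move=> CD C'D; rewrite !mem_stretch.
  case/exists_inP=> x xC xu /exists_inP[x' xC' xu'].
  suff xx : x = x'.
    by rewrite -(def_pblock trivD CD xC) xx (def_pblock trivD C'D xC').
  case/orP: xu => /andP[xm /eqP eu]; case/orP: xu' => /andP[xm' /eqP eu'].
  - by apply: f_inj; rewrite -eu.
  - by have := rU_g xm'; rewrite -eu' eu rU_f //; lia.
  - by have := rU_g xm; rewrite -eu eu' rU_f //; lia.
  - by apply: g_inj; rewrite -eu.
have mem_ex C x : C \in D -> x \in C -> exists u, u \in stretch C.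
  move=> CD xC; have [xm|xm] := leqP (rT x) m; [exists (f x)|exists (g x)];
    by rewrite mem_stretch; apply/exists_inP; exists x;
       rewrite ?xm ?(ltnW xm) ?eqxx ?orbT.
apply/and3P; split.
- rewrite eqEsubset subsetT; apply/subsetP=> u _.
  have [x ux] :
      exists x, (rT x <= m) && (u == f x) || (m <= rT x) && (u == g x).
    have [/f_surj[x xm ->]|/g_surj[x xm ->]] := leqP (rU u) m;
      by exists x; rewrite xm eqxx ?orbT.
  have : x \in cover D by rewrite covD.
  case/bigcupP=> C CD xC; apply/bigcupP; exists (stretch C); first exact: imset_f.
  by rewrite mem_stretch; apply/exists_inP; exists x.
- apply/trivIsetP=> _ _ /imsetP[C CD ->] /imsetP[C' C'D ->].
  apply: contraNT; rewrite -setI_eq0 => /set0Pn[u /setIP[uC uC']].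
  by rewrite (block _ _ _ CD C'D uC uC').
- apply/negP=> /imsetP[C CD C0].
  have [C_0|[x xC]] := set_0Vmem C; first by rewrite -C_0 CD in D0.
  by have [u] := mem_ex _ _ CD xC; rewrite -C0 inE.
Qed.

(** The booleans count as 0 or 1. The sum of the end ranks grows by 0, 1 or 2 according to whether
    the chain lies below rank [m], meets it, or lies above it. *)
Lemma stretch_ends (D : {set {set T}}) C u v :
    chain_decomposition D -> C \in stretch @: D -> is_min C u -> is_max C v ->
  exists C' x y, [/\ C' \in D, is_min C' x, is_max C' y & rT x <= rT y] /\
    rU u = rT x + (m < rT x) /\ rU v = rT y + (m <= rT y).
Proof.
move=> [_ satD] /imsetP[C' C'D ->] uC vC.
have [x [s [xs eC']]] := satD _ C'D; subst C'.
exists [set z in x :: s], x, (last x s); split.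
  by rewrite C'D is_min_head // is_max_last // rank_path.
have [w [xw eC elast]] := stretch_path xs.
rewrite eC in uC vC.
rewrite (is_min_unique uC (is_min_head xw)) (is_max_unique vC (is_max_last xw)).
rewrite elast /stretch_min /stretch_max; split; case: leqP => h.
- by rewrite rU_f ?addn0.
- by rewrite rU_g ?addn1 // ltnW.
- by rewrite rU_g ?addn1.
- by rewrite rU_f ?addn0 // ltnW.
Qed.

Lemma stretch_NCD (D : {set {set T}}) : NCD rT D -> NCD rU (stretch @: D).
Proof.
case=> cD nD; split=> [|C C' u v u' v' CD C'D uC vC uC' vC'].
  exact: stretch_CD.
have [E [x [y [[ED xE yE xy] [rx ry]]]]] := stretch_ends cD CD uC vC.
have [E' [x' [y' [[ED' xE' yE' xy'] [rx' ry']]]]] := stretch_ends cD C'D uC' vC'.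
(* Both end maps are monotone; [step] keeps the new intervals nonempty, as [interval_subsetP]
   requires. *)
have lo i j : i <= j -> i + (m < i) <= j + (m < j) by clear; lia.
have hi i j : i <= j -> i + (m <= i) <= j + (m <= j) by clear; lia.
have step i j : i <= j -> i + (m < i) <= j + (m <= j) by clear; lia.
have [] := nD _ _ _ _ _ _ ED ED' xE yE xE' yE' => /interval_subsetP.
  move=> /(_ xy)/andP[h h']; left; apply/interval_subsetP.
    by rewrite rx ry step.
  by rewrite rx ry rx' ry' lo ?hi.
move=> /(_ xy')/andP[h h']; right; apply/interval_subsetP.
  by rewrite rx' ry' step.
by rewrite rx ry rx' ry' lo ?hi.
Qed.

Lemma stretch_exists_NCD (D : {set {set T}}) : NCD rT D ->
  exists2 D' : {set {set U}}, NCD rU D' &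
    forall C u v, C \in D' -> is_min C u -> is_max C v ->
    exists C' x y, [/\ C' \in D, is_min C' x, is_max C' y & rT x <= rT y] /\
      rU u = rT x + (m < rT x) /\ rU v = rT y + (m <= rT y).
Proof.
move=> nD; exists (stretch @: D); first exact: stretch_NCD.
by move=> C u v; apply: stretch_ends; case: nD.
Qed.

End Stretching.

(** * Segments of a fence and the rank of an ideal *)

Section Fences.
Context {alpha : seq nat}.
Implicit Types (x y : fence alpha) (I J : L alpha) (i j : nat).

(** Total in [j]: an index beyond [sumn alpha] falls back to element 0, whence the bounds in later
    lemmas. *)
Definition fence_elt alpha j : fence alpha := Elt (inord j).

Lemma fence_index_elt j : j <= sumn alpha -> fence_index (fence_elt alpha j) = j.
Proof. exact: inordK. Qed.

Lemma fence_elt_index x : fence_elt alpha (fence_index x) = x.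
Proof. by apply: fence_index_inj; rewrite fence_index_elt // -ltnS ltn_ord. Qed.

Lemma fence_index_le x : fence_index x <= sumn alpha.
Proof. by rewrite -ltnS ltn_ord. Qed.

Lemma sumn_take_le i : sumn (take i alpha) <= sumn alpha.
Proof. by rewrite -{2}(cat_take_drop i alpha) sumn_cat leq_addr. Qed.

Lemma sumn_take_mono i j : i <= j -> sumn (take i alpha) <= sumn (take j alpha).
Proof. by move=> lemn; rewrite -(subnKC lemn) takeD sumn_cat leq_addr. Qed.

(** Consecutive covers inside a segment compose, by induction on the distance of the indices; the
    parity of [i] gives the direction. *)
Lemma segment_le i x y : i < size alpha ->
    x \in segment alpha i -> y \in segment alpha i ->
    (if odd i then fence_index y <= fence_index x
     else fence_index x <= fence_index y) ->
  (x <= y)%O.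
Proof.
move=> ilt; rewrite !inE.
have chain j n : sumn (take i alpha) <= j -> j + n <= sumn (take i.+1 alpha) ->
    if odd i then (fence_elt alpha (j + n) <= fence_elt alpha j)%O
    else (fence_elt alpha j <= fence_elt alpha (j + n))%O.
  move=> lo; elim: n => [|n IH] hi; first by rewrite addn0 lexx if_same.
  have := sumn_take_le i.+1.
  have {}IH := IH (leq_trans (leq_add (leqnn j) (leqnSn n)) hi) => le_a.
  have edge : if odd i
      then fence_cover (fence_elt alpha (j + n.+1)) (fence_elt alpha (j + n))
      else fence_cover (fence_elt alpha (j + n)) (fence_elt alpha (j + n.+1)).
    by case: ifP => oi; apply/existsP; exists (Ordinal ilt);
      rewrite !inE /= oi !fence_index_elt; lia.
  case: (odd i) edge IH => /connect1 edge IH.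
    exact: le_trans edge IH.
  exact: le_trans IH edge.
move=> /andP[xlo xhi] /andP[ylo yhi] xy.
case: (odd i) xy chain => xy chain.
  have := chain _ (fence_index x - fence_index y) ylo.
  by rewrite subnKC // !fence_elt_index; apply.
have := chain _ (fence_index y - fence_index x) xlo.
by rewrite subnKC // !fence_elt_index; apply.
Qed.

Lemma fence_cover_segment x y : fence_cover x y ->
  exists i, [/\ i < size alpha, x \in segment alpha i, y \in segment alpha i
    & if odd i then fence_index x = (fence_index y).+1
      else fence_index y = (fence_index x).+1].
Proof.
case/existsP=> i /and3P[xi yi xy]; exists i; split=> //.
by case: ifP xy => _ /eqP.
Qed.

Lemma card_fence : #|{: fence alpha}| = (sumn alpha).+1.
Proof.
rewrite -[RHS]card_ord; apply: (bij_eq_card (f := @fence_ord alpha)).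
by exists (@Elt alpha) => // -[].
Qed.

Lemma leq_card_interval (A : {set fence alpha}) lo n :
    lo + n <= (sumn alpha).+1 ->
    (forall j, lo <= j < lo + n -> fence_elt alpha j \in A) ->
  n <= #|A|.
Proof.
move=> len inA; pose h (k : 'I_n) := fence_elt alpha (lo + k).
have hE k : fence_index (h k) = lo + k.
  by rewrite fence_index_elt //; have := ltn_ord k; lia.
have h_inj : injective h.
  by move=> k k' /(congr1 (@fence_index alpha)); rewrite !hE => /addnI/val_inj.
rewrite -[n]card_ord -cardsT -(card_imset _ h_inj).
apply/subset_leq_card/subsetP=> _ /imsetP[k _ ->]; apply: inA.
by have := ltn_ord k; lia.
Qed.

(** The ideal contains [x] and all that lies below it in its segment, a run of consecutive indices
    with one more element than the difference shown. *)
Lemma ideal_rank_segment_in i I x : i < size alpha -> x \in segment alpha i ->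
    x \in ideal_set I ->
  (if odd i then sumn (take i.+1 alpha) - fence_index x
   else fence_index x - sumn (take i alpha)) < ideal_rank I.
Proof.
move=> ilt xi xI; have := sumn_take_le i.+1.
have := xi; rewrite inE => /andP[lo hi] le_a.
case oi: (odd i).
  apply: (@leq_card_interval _ (fence_index x)); first lia.
  move=> j jlt; apply: idealE xI; apply: (segment_le ilt) => //.
    by rewrite inE fence_index_elt; lia.
  by rewrite oi fence_index_elt; lia.
apply: (@leq_card_interval _ (sumn (take i alpha))); first lia.
move=> j jlt; apply: idealE xI; apply: (segment_le ilt) => //.
  by rewrite inE fence_index_elt; lia.
by rewrite oi fence_index_elt; lia.
Qed.

(** Dually, the complement is an upper set and contains the part of the segment weakly above [x];
    ideal and complement together have [sumn alpha + 1] elements. *)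
Lemma ideal_rank_segment_notin i I x : i < size alpha -> x \in segment alpha i ->
    x \notin ideal_set I ->
  ideal_rank I + (if odd i then fence_index x - sumn (take i alpha)
                  else sumn (take i.+1 alpha) - fence_index x) <= sumn alpha.
Proof.
move=> ilt xi xI; have := sumn_take_le i.+1.
have := xi; rewrite inE => /andP[lo hi] le_a.
have up n : n < #|~: ideal_set I| -> ideal_rank I + n <= sumn alpha.
  by move=> nlt; rewrite -ltnS -card_fence -(cardsC (ideal_set I)) -addnS leq_add2l.
apply: up; case oi: (odd i).
  apply: (@leq_card_interval _ (sumn (take i alpha))); first lia.
  move=> j jlt; rewrite inE; apply: contra xI; apply: idealE.
  apply: (segment_le ilt) => //; first by rewrite inE fence_index_elt; lia.
  by rewrite oi fence_index_elt; lia.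
apply: (@leq_card_interval _ (fence_index x)); first lia.
move=> j jlt; rewrite inE; apply: contra xI; apply: idealE.
apply: (segment_le ilt) => //; first by rewrite inE fence_index_elt; lia.
by rewrite oi fence_index_elt; lia.
Qed.

(** Rank is strictly monotone, so nothing fits between ideals of consecutive ranks. *)
Lemma covers_ideal_rank I J :
  (I <= J)%O -> ideal_rank J = (ideal_rank I).+1 -> covers I J.
Proof.
move=> IJ rIJ.
have rank_lt (K K' : L alpha) : (K < K')%O -> ideal_rank K < ideal_rank K'.
  by rewrite lt_leAnge !leL => KK; apply: proper_card; rewrite properE.
apply/andP; split.
  by rewrite lt_neqAle IJ andbT; apply/eqP=> eIJ; move: rIJ; rewrite eIJ; lia.
by apply/forallP=> K; apply/negP=> /andP[/rank_lt IK /rank_lt KJ]; lia.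
Qed.

End Fences.

(** * Monotone maps of fences and preimages of ideals *)

Lemma fence_homo (alpha gamma : seq nat) (h : fence alpha -> fence gamma) :
    (forall x y, fence_cover x y -> (h x <= h y)%O) ->
  {homo h : x y / (x <= y)%O}.
Proof.
move=> hcov x _ /connectP[s xs ->].
elim: s x xs => //= y s IH x /andP[/hcov xy /IH].
exact: le_trans.
Qed.

Section Preimage.
Context (alpha gamma : seq nat) (h : fence alpha -> fence gamma).
Context (h_homo : {homo h : x y / (x <= y)%O}).

Lemma preim_lower_ideal (I : L gamma) : lower_ideal (h @^-1: ideal_set I).
Proof.
apply/forallP=> x; apply/forallP=> y; apply/implyP=> /andP[/h_homo xy].
by rewrite !inE; apply: idealE.
Qed.

Definition preim_ideal (I : L gamma) : L alpha := Ideal (preim_lower_ideal I).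

Lemma mem_preim_ideal I x :
  (x \in ideal_set (preim_ideal I)) = (h x \in ideal_set I).
Proof. by rewrite inE. Qed.

Lemma preim_ideal_le I J : (I <= J)%O -> (preim_ideal I <= preim_ideal J)%O.
Proof. by rewrite !leL; apply: preimsetS. Qed.

End Preimage.

(** Prefix sums are the segment boundaries, so this locates the segments of the longer fence. *)
Lemma sumn_take_set_nth (s : seq nat) t i : t < size s ->
  sumn (take i (set_nth 0 s t (nth 0 s t + 1))) = sumn (take i s) + (t < i).
Proof.
elim: s t i => // a s IH [|t] [|i] //=; first lia.
by move=> tlt; rewrite IH // addnA.
Qed.

(** * Lengthening a segment by doubling one of its elements *)

Section LongerSegment.
Context (alpha : seq nat) (t : nat) (t_lt : t < size alpha).

Local Notation beta := (set_nth 0 alpha t (nth 0 alpha t + 1)).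
Local Notation p := (sumn (take t alpha)).
Local Notation a := (nth 0 alpha t).

Lemma size_longer : size beta = size alpha.
Proof. by rewrite size_set_nth; apply/maxn_idPr. Qed.

Lemma sumn_longer : sumn beta = (sumn alpha).+1.
Proof.
have := sumn_take_set_nth (size alpha) t_lt.
by rewrite take_oversize ?size_longer // take_size t_lt [_ + true]addn1.
Qed.

Lemma sumn_take_next : sumn (take t.+1 alpha) = p + a.
Proof. by rewrite (take_nth 0) // sumn_rcons. Qed.

(* For p <= q <= p + a this merges the elements [q] and [q.+1] of the lengthened
   segment; [expand h] is a section of it that omits [h], which is [q] or [q.+1].
   The range of [h] in [expand_homo] keeps the hole inside the segment, so that
   the two neighbours of [h] remain comparable. *)
Definition collapse q (u : fence beta) : fence alpha :=
  fence_elt alpha (unbump q (fence_index u)).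

Definition expand h (x : fence alpha) : fence beta :=
  fence_elt beta (bump h (fence_index x)).

Lemma index_collapse q u : q <= sumn alpha ->
  fence_index (collapse q u) = unbump q (fence_index u).
Proof.
move=> qle; rewrite fence_index_elt // /unbump.
by have := fence_index_le u; rewrite sumn_longer; lia.
Qed.

Lemma index_expand h x : fence_index (expand h x) = bump h (fence_index x).
Proof.
rewrite fence_index_elt // sumn_longer /bump.
by have := fence_index_le x; lia.
Qed.

Lemma segment_bound : p + a <= sumn alpha.
Proof. by rewrite -sumn_take_next sumn_take_le. Qed.

(** Supplies the linear facts about boundaries with which [lia] checks that [collapse] and [expand]
    respect segments. *)
Lemma segment_bounds i :
  [\/ [/\ i < t & sumn (take i.+1 alpha) <= p],
      [/\ i = t, sumn (take i alpha) = p & sumn (take i.+1 alpha) = p + a]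
    | [/\ t < i & p + a <= sumn (take i alpha)]].
Proof.
case: (ltngtP i t) => it; first by constructor 1; split=> //; apply: sumn_take_mono.
  by constructor 3; rewrite -sumn_take_next; split=> //; apply: sumn_take_mono.
by constructor 2; rewrite it sumn_take_next.
Qed.

(** An edge goes to an edge of the segment with the same number, or to a single point when it joins
    [q] and [q.+1]. *)
Lemma collapse_homo q : p <= q <= p + a -> {homo collapse q : u v / (u <= v)%O}.
Proof.
move=> qpa; apply: fence_homo => u v /fence_cover_segment[i [ilt]].
rewrite !inE !sumn_take_set_nth // size_longer in ilt * => ui vi uv.
have qle : q <= sumn alpha by have := segment_bound; lia.
apply: (segment_le ilt); rewrite ?inE ?index_collapse // /unbump.
- case: (segment_bounds i) ui vi uv => [[]|[]|[]]; case: (odd i); lia.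
- case: (segment_bounds i) ui vi uv => [[]|[]|[]]; case: (odd i); lia.
- case: (odd i) uv; lia.
Qed.

Lemma expand_homo h : p < h <= p + a -> {homo expand h : x y / (x <= y)%O}.
Proof.
move=> hpa; apply: fence_homo => x y /fence_cover_segment[i [ilt]].
rewrite !inE => xi yi xy.
rewrite -size_longer in ilt.
apply: (segment_le ilt); rewrite ?inE ?index_expand ?sumn_take_set_nth // /bump.
- case: (segment_bounds i) xi yi xy => [[]|[]|[]]; case: (odd i); lia.
- case: (segment_bounds i) xi yi xy => [[]|[]|[]]; case: (odd i); lia.
- case: (odd i) xy; lia.
Qed.

Section Hole.
Context (q h : nat) (q_range : p <= q <= p + a) (h_range : p < h <= p + a)
  (qh : q <= h <= q.+1).

Let q_le : q <= sumn alpha.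
Proof. by have := segment_bound; lia. Qed.

Lemma expandK : cancel (expand h) (collapse q).
Proof.
move=> x; apply: fence_index_inj.
by rewrite index_collapse // index_expand /bump /unbump; lia.
Qed.

Lemma collapseK u : fence_index u != h -> expand h (collapse q u) = u.
Proof.
move=> uh; apply: fence_index_inj.
by rewrite index_expand index_collapse // /bump /unbump; lia.
Qed.

Lemma collapse_hole : collapse q (fence_elt beta h) = fence_elt alpha q.
Proof.
apply: fence_index_inj; have := segment_bound; rewrite index_collapse //.
by rewrite !fence_index_elt // ?sumn_longer /unbump; lia.
Qed.

(** The section [expand h] copies [A] into the preimage; the only other candidate is the hole, which
    lies over [q]. *)
Lemma card_preim_collapse (A : {set fence alpha}) :
  #|collapse q @^-1: A| = #|A| + (fence_elt alpha q \in A).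
Proof.
rewrite (cardsD1 (fence_elt beta h)) inE collapse_hole addnC; congr (_ + _).
rewrite -(card_imset A (can_inj expandK)); apply: eq_card => u; rewrite !inE.
have hE : fence_index (fence_elt beta h) = h.
  by rewrite fence_index_elt // sumn_longer; have := segment_bound; lia.
apply/andP/imsetP => [[uh uA]|[x xA ->]].
  exists (collapse q u) => //; rewrite collapseK //.
  by apply: contra uh => /eqP uh; apply/eqP/fence_index_inj; rewrite hE.
rewrite expandK; split=> //; apply/eqP=> /(congr1 (@fence_index _)).
by rewrite hE index_expand /bump; lia.
Qed.

Definition lift_ideal : L alpha -> L beta := preim_ideal (collapse_homo q_range).

Lemma lift_ideal_inj : injective lift_ideal.
Proof.
move=> I J IJ; apply/val_inj/setP=> x /=.
by rewrite -(expandK x) -!(mem_preim_ideal (collapse_homo q_range)) -/lift_ideal IJ.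
Qed.

Lemma ideal_rank_lift I :
  ideal_rank (lift_ideal I) = ideal_rank I + (fence_elt alpha q \in ideal_set I).
Proof. exact: card_preim_collapse. Qed.

(** An ideal that does not separate the two copies of [q] is recovered from its restriction along
    [expand h]. *)
Lemma lift_ideal_surj (V : L beta) :
    (fence_elt beta q \in ideal_set V) = (fence_elt beta q.+1 \in ideal_set V) ->
  exists2 I, V = lift_ideal I & (fence_elt alpha q \in ideal_set I)
                              = (fence_elt beta q \in ideal_set V).
Proof.
move=> qV.
(* [bump h q] is the copy of [q] other than the hole. *)
have hV : (fence_elt beta (bump h q) \in ideal_set V)
        = (fence_elt beta h \in ideal_set V).
  have [->|->] : h = q \/ h = q.+1 by lia.
    by rewrite /bump leqnn add1n qV.
  by rewrite /bump ltnn add0n qV.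
exists (preim_ideal (expand_homo h_range) V).
  apply/val_inj/setP=> u /=; rewrite !inE.
  have [uh|/collapseK ->//] := eqVneq (fence_index u) h.
  by rewrite -(fence_elt_index u) uh collapse_hole /expand fence_index_elt.
rewrite mem_preim_ideal /expand fence_index_elt // hV.
by have [->|->] : h = q \/ h = q.+1 by lia.
Qed.

End Hole.

End LongerSegment.

(** * Stretching the decomposition of the ideal lattice *)

Section LongerNCD.
Context (alpha : seq nat) (t : nat) (t_lt : t < size alpha).

Local Notation beta := (set_nth 0 alpha t (nth 0 alpha t + 1)).
Local Notation p := (sumn (take t alpha)).
Local Notation a := (nth 0 alpha t).

(** The first inequality says, without subtraction, that the other parts sum to less than [m].
    Stretching is applied with [f] doubling the top of the segment and [g] doubling its bottom. *)
Lemma NCD_longer_segment m (D : {set {set L alpha}}) :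
    sumn alpha < m + a -> m <= a -> NCD (@ideal_rank alpha) D ->
  exists2 D', NCD (@ideal_rank beta) D' &
    forall C u v, C \in D' -> is_min C u -> is_max C v ->
    exists C' x y, [/\ C' \in D, is_min C' x, is_max C' y
                     & ideal_rank x <= ideal_rank y] /\
      ideal_rank u = ideal_rank x + (m < ideal_rank x) /\
      ideal_rank v = ideal_rank y + (m <= ideal_rank y).
Proof.
move=> lt_m le_m; have le_pa := segment_bound t_lt.
have nextE := sumn_take_next t_lt.
(* An even [t] ascends, an odd one descends. The hole must be interior to the lengthened segment, so
   of the two copies of an end the inner one is omitted. *)
pose top := if odd t then p else p + a; pose htop := if odd t then p.+1 else p + a.
pose bot := if odd t then p + a else p; pose hbot := if odd t then p + a else p.+1.
have top_range : p <= top <= p + a by rewrite /top; case: (odd t); lia.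
have bot_range : p <= bot <= p + a by rewrite /bot; case: (odd t); lia.
have top_le : top <= sumn alpha by lia.
have bot_le : bot <= sumn alpha by lia.
have htop_range : p < htop <= p + a by rewrite /htop; case: (odd t); lia.
have hbot_range : p < hbot <= p + a by rewrite /hbot; case: (odd t); lia.
have top_htop : top <= htop <= top.+1 by rewrite /top /htop; case: (odd t); lia.
have bot_hbot : bot <= hbot <= bot.+1 by rewrite /bot /hbot; case: (odd t); lia.
pose f := lift_ideal t_lt top_range; pose g := lift_ideal t_lt bot_range.
(* Containing the top forces all [a + 1] elements of the segment, more than [m]. *)
have notin_top (I : L alpha) :
    ideal_rank I <= m -> fence_elt alpha top \notin ideal_set I.
  move=> Im; apply/negP=> /(ideal_rank_segment_in t_lt).
  rewrite inE fence_index_elt ?nextE /top; last by case: (odd t); lia.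
  by case: (odd t); lia.
(* Missing the bottom loses all [a + 1] elements of the segment, leaving rank below [m]. *)
have in_bot (I : L alpha) :
    m <= ideal_rank I -> fence_elt alpha bot \in ideal_set I.
  move=> Im; apply: contraT => /(ideal_rank_segment_notin t_lt).
  rewrite inE fence_index_elt ?nextE /bot; last by case: (odd t); lia.
  by case: (odd t); lia.
have rank_f I :
    ideal_rank (f I) = ideal_rank I + (fence_elt alpha top \in ideal_set I).
  exact: ideal_rank_lift htop_range top_htop I.
have rank_g I :
    ideal_rank (g I) = ideal_rank I + (fence_elt alpha bot \in ideal_set I).
  exact: ideal_rank_lift hbot_range bot_hbot I.
have rank_fm I : ideal_rank I <= m -> ideal_rank (f I) = ideal_rank I.
  by move=> /notin_top/negPf It; rewrite rank_f It addn0.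
have rank_gm I : m <= ideal_rank I -> ideal_rank (g I) = (ideal_rank I).+1.
  by move=> /in_bot It; rewrite rank_g It addn1.
have t_lt' : t < size beta by rewrite size_longer.
have nextE' : sumn (take t.+1 beta) = p + a.+1.
  by rewrite sumn_take_set_nth // nextE ltnSn -addnA [a + _]addn1.
have takeE' : sumn (take t beta) = p by rewrite sumn_take_set_nth // ltnn addn0.
have sumE' := sumn_longer t_lt.
apply: (stretch_exists_NCD (f := f) (g := g)) => //.
- exact: ideal_rank_covers.
- exact: lift_ideal_inj htop_range top_htop.
- exact: lift_ideal_inj hbot_range bot_hbot.
- move=> I J Jm /[dup] /ideal_rank_covers IJ /andP[/ltW leIJ _].
  apply: covers_ideal_rank; first exact: preim_ideal_le.
  by rewrite !rank_fm // ltnW // -IJ.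
- move=> I J Im /[dup] /ideal_rank_covers IJ /andP[/ltW leIJ _].
  apply: covers_ideal_rank; first exact: preim_ideal_le.
  by rewrite !rank_gm ?IJ // ltnW // ltnS.
- move=> I Im; apply: covers_ideal_rank; last by rewrite rank_fm ?rank_gm ?Im.
  rewrite leL; apply/subsetP=> u; rewrite !mem_preim_ideal; apply: idealE.
  (* The two collapses differ only inside the segment, where merging at the bottom gives the lower
     of the two elements. *)
  have [] := boolP ((collapse top u \in segment alpha t)
                    && (collapse bot u \in segment alpha t)).
    case/andP=> ut ub; apply: (segment_le t_lt) => //.
    by rewrite !index_collapse // /top /bot /unbump; case: (odd t); lia.
  rewrite !inE !index_collapse // => uN.
  suff -> : collapse bot u = collapse top u by [].
  apply: fence_index_inj; rewrite !index_collapse //.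
  by move: uN; rewrite nextE /top /bot /unbump; case: (odd t); lia.
- move=> V Vm.
  (* At least [a + 1] of the [a + 2] elements of the longer segment lie weakly below either copy of
     the top, so rank at most [m] excludes both copies. *)
  have notin j : (if odd t then p <= j <= p.+1 else p + a <= j <= p + a.+1) ->
      (fence_elt beta j \in ideal_set V) = false.
    move=> jr; apply/negP=> /(ideal_rank_segment_in t_lt').
    by rewrite inE nextE' takeE' fence_index_elt; case: (odd t) jr; lia.
  have [|I eV It] := lift_ideal_surj t_lt top_range htop_range top_htop (V := V).
    by rewrite !notin // /top; case: (odd t); lia.
  rewrite notin in It; last by rewrite /top; case: (odd t); lia.
  by exists I => //; move: Vm; rewrite eV rank_f It addn0.
- move=> V Vm.
  (* Likewise at least [a + 1] elements lie weakly above either copy of the bottom; missing one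
     would leave rank at most [m]. *)
  have is_in j : (if odd t then p + a <= j <= p + a.+1 else p <= j <= p.+1) ->
      fence_elt beta j \in ideal_set V.
    move=> jr; apply: contraT => /(ideal_rank_segment_notin t_lt').
    by rewrite inE nextE' takeE' fence_index_elt; case: (odd t) jr; lia.
  have [|I eV It] := lift_ideal_surj t_lt bot_range hbot_range bot_hbot (V := V).
    by rewrite !is_in // /bot; case: (odd t); lia.
  rewrite is_in in It; last by rewrite /bot; case: (odd t); lia.
  by exists I => //; move: Vm; rewrite eV rank_g It addn1.
Qed.

End LongerNCD.

(** * Centers of the new chains and the theorem *)

(** Clears denominators, so that conditions on centers become equations between sums of ranks. *)
Lemma center_of_eq d (T : finPOrderType d) (rk : T -> nat) x y k :
  (center_of rk x y == k%:R / 2)%R = (rk x + rk y == k).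
Proof.
rewrite /center_of -natrD -(inj_eq (mulIf (x := 2%R) _)) // !divfK //.
by rewrite eqr_nat.
Qed.

Theorem theorem3p4 (alpha : seq nat) (t : 'I_(size alpha))
    (Halpha : composition alpha)
    (Ht : \sum_(i < size alpha | i != t) nth 0 alpha i < nth 0 alpha t) :
  let beta := set_nth 0 alpha t (nth 0 alpha t + 1) in
  let NL := #|{: fence alpha}| in
  let NM := #|{: fence beta}| in
  [/\ (exists D, NCD (@ideal_rank alpha) D) ->
      (exists D, NCD (@ideal_rank beta) D),
      (exists D, NCD (@ideal_rank alpha) D /\
                 symmetric_CD (@ideal_rank alpha) NL D) ->
      (exists D, NCD (@ideal_rank beta) D /\
                 symmetric_CD (@ideal_rank beta) NM D),
      (exists D, NCD (@ideal_rank alpha) D /\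
                 top_centered_CD (@ideal_rank alpha) NL D) ->
      (exists D, NCD (@ideal_rank beta) D /\
                 top_centered_CD (@ideal_rank beta) NM D)
    & (exists D, NCD (@ideal_rank alpha) D /\
                 bottom_centered_CD (@ideal_rank alpha) NL D) ->
      (exists D, NCD (@ideal_rank beta) D /\
                 bottom_centered_CD (@ideal_rank beta) NM D)].
Proof.
move=> beta NL NM.
have NLE : NL = (sumn alpha).+1 by exact: card_fence.
have NME : NM = (sumn alpha).+2 by rewrite /NM card_fence sumn_longer.
have lt_sum : sumn alpha < nth 0 alpha t + nth 0 alpha t.
  by rewrite sumnE (big_nth 0) big_mkord (bigD1 t) //= ltn_add2l.
have stretch m D := @NCD_longer_segment alpha t (ltn_ord t) m D.
rewrite -/beta in stretch.
(* Since [NL] is at most twice the [t]-th part, both roundings of [NL / 2] are admissible values of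
   [m]. *)
have half_lt : sumn alpha < NL./2 + nth 0 alpha t by rewrite NLE; lia.
have half_le : NL./2 <= nth 0 alpha t by rewrite NLE; lia.
have uphalf_lt : sumn alpha < uphalf NL + nth 0 alpha t by rewrite NLE; lia.
have uphalf_le : uphalf NL <= nth 0 alpha t by rewrite NLE; lia.
have natr1E n : (n%:R + 1 = n.+1%:R :> rat)%R by rewrite -natr1.
have natrB1 n : (n.+1%:R - 1 = n%:R :> rat)%R by rewrite -natr1 addrK.
split=> -[D].
- by move=> nD; have [D' nD' _] := stretch _ D half_lt half_le nD; exists D'.
(* End ranks with sum [NL] enclose the rounded-down half, so only the maximum rises and the sum
   becomes [NM]. *)
- case=> nD cD; have [D' nD' ends] := stretch _ D half_lt half_le nD.
  exists D'; split=> // C u v CD' uC vC.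
  have [C' [x [y [[C'D xC' yC' xy] [ru rv]]]]] := ends C u v CD' uC vC.
  have := cD C' x y C'D xC' yC'; move: ru rv.
  rewrite !inE NME NLE ?natr1E ?natrB1 !center_of_eq => -> ->.
  clear -xy; lia.
(* With sum [NL] or [NL + 1] every chain meets the rounded-up half; rounding down could miss a
   one-element chain when [NL] is odd. *)
- case=> nD cD; have [D' nD' ends] := stretch _ D uphalf_lt uphalf_le nD.
  exists D'; split=> // C u v CD' uC vC.
  have [C' [x [y [[C'D xC' yC' xy] [ru rv]]]]] := ends C u v CD' uC vC.
  have := cD C' x y C'D xC' yC'; move: ru rv.
  rewrite !inE NME NLE ?natr1E ?natrB1 !center_of_eq => -> ->.
  clear -xy; lia.
(* With sum [NL] or [NL - 1] every chain meets the rounded-down half. *)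
- case=> nD cD; have [D' nD' ends] := stretch _ D half_lt half_le nD.
  exists D'; split=> // C u v CD' uC vC.
  have [C' [x [y [[C'D xC' yC' xy] [ru rv]]]]] := ends C u v CD' uC vC.
  have := cD C' x y C'D xC' yC'; move: ru rv.
  rewrite !inE NME NLE ?natr1E ?natrB1 !center_of_eq => -> ->.
  clear -xy; lia.
Qed.
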